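(* Let $\ell$ be a prime power. There exist $3(\ell^2-\ell+1)$ coplanar points contained in $\mathcal{GK}(\mathbb{F}_{\ell^6})$ lying on the intersection between a cubic curve and a curve $\mathcal{Y}$ of degree $\ell^2-\ell+1$.
   Context: $\ell=p^h$ with $p$ prime and $h\ge 1$. $PG(3,\ell^6)$ is the three-dimensional projective space over the field $\mathbb{F}_{\ell^6}$, with homogeneous coordinates $(X:Y:Z:T)$; affine points are those with $T=1$. The Giulietti-Korchmáros curve $\mathcal{GK}$ is the non-singular projective curve in $PG(3,\ell^6)$ with affine equations $$Z^{\ell^2-\ell+1}=Y^{\ell^2}-Y,\qquad Y^{\ell+1}=X^\ell+X,$$ having a unique point at infinity $P_\infty=(1:0:0:0)$. $\mathcal{GK}(\mathbb{F}_{\ell^6})$ denotes the set of its $\mathbb{F}_{\ell^6}$-rational points (including $P_\infty$). The cubic curve and the curve $\mathcal{Y}$ are plane curves in $PG(3,\ell^6)$ and are allowed to be reducible. *)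

(* Defs.v *)
From HB Require Import structures.
From mathcomp Require Import all_boot all_order all_algebra.
From mathcomp Require Import mpoly.

Set Implicit Arguments.
Unset Strict Implicit.
Unset Printing Implicit Defensive.

Import GRing.Theory.
Local Open Scope ring_scope.

Definition PG (n : nat) (F : fieldType) : Type :=
  {P : {vspace 'rV[F]_n.+1} | \dim P == 1%N}.

Definition vanishes_at (n : nat) (F : fieldType) (f : {mpoly F[n.+1]})
    (P : PG n F) : Prop :=
  forall v : 'rV[F]_n.+1, v \in val P -> f.@[v 0] = 0.

Definition is_plane (F : fieldType) (H : {mpoly F[4]}) : Prop :=
  H \is 1.-homog /\ H != 0.

(* The degree d curves of the plane H = 0 are its sections by the forms of
   degree d that do not vanish identically on it.  As the field is finite, this
   is expressed by non-divisibility by H rather than by values at points. *)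
Definition is_plane_curve (F : fieldType) (H : {mpoly F[4]}) (d : nat)
    (f : {mpoly F[4]}) : Prop :=
  f \is d.-homog /\ ~ (exists g : {mpoly F[4]}, f = g * H).

Definition on_plane_curve (F : fieldType) (H f : {mpoly F[4]})
    (P : PG 3 F) : Prop :=
  vanishes_at H P /\ vanishes_at f P.

Definition hcoord (F : fieldType) (x y z t : F) : 'rV[F]_4 :=
  \row_(i < 4) [:: x; y; z; t]`_i.

(* The rational points are the affine ones together with (1 : 0 : 0 : 0);
   homogenizing the two affine equations would instead add the whole line
   Y = T = 0 at infinity. *)
Definition on_GK (F : fieldType) (l : nat) (P : PG 3 F) : Prop :=
  val P = <[hcoord 1 0 0 0]>%VS \/
  exists x y z : F,
    [/\ val P = <[hcoord x y z 1]>%VS,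
        z ^+ (l ^ 2 - l + 1) = y ^+ (l ^ 2) - y
      & y ^+ (l + 1) = x ^+ l + x].

(* Main.v *)
(* Put m = l^2 - l + 1 and take a rational point (x, y, z) of the GK curve with
   y outside the field with l^2 elements.  If zeta^(l+1) = 1, then zeta is fixed
   by the l^2-power map and is an m-th power, say eta^m.  Hence the 3m points
   (x, y zeta^i, z eta^i omega^j), with i < 3, j < m and omega a primitive m-th
   root of unity, are rational points of the curve.  They lie in the plane
   X = x T, on the three lines Y = y zeta^i T, and on the curve
   y Z^m = (y^(l^2) - y) Y T^(m-1). *)

Require Import Defs.
From HB Require Import structures.
From mathcomp Require Import all_boot all_order all_algebra all_field all_solvable.
From mathcomp Require Import mpoly zify ring.

Set Implicit Arguments.
Unset Strict Implicit.
Unset Printing Implicit Defensive.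

Import GRing.Theory.
Local Open Scope ring_scope.

(** * Roots of unity and powers in finite fields *)

Lemma finField_prim_root (F : finFieldType) :
  exists g : F, #|F|.-1.-primitive_root g.
Proof.
have F_gt1 := finNzRing_gt1 F.
suff /hasP[g _ g_prim] :
  has #|F|.-1.-primitive_root (enum (predC1 (0 : F))) by exists g.
apply: has_prim_root.
- by rewrite -subn1 subn_gt0.
- apply/allP=> x; rewrite mem_enum unity_rootE => /= x_neq0.
  apply/eqP/(mulfI x_neq0); rewrite -exprS mulr1 prednK ?expf_card //.
  exact: ltnW.
- exact: enum_uniq.
- by rewrite -cardE cardC1.
Qed.

Lemma exprBn_pchar (R : comNzRingType) (x y : R) (n : nat) :
  [pchar R].-nat n -> (x - y) ^+ n = x ^+ n - y ^+ n.
Proof.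
move=> n_char; apply/eqP; rewrite eq_sym subr_eq.
by rewrite -exprDn_pchar // subrK.
Qed.

Lemma GK_degreeM (l : nat) : ((l ^ 2 - l + 1) * l.+1 = (l ^ 3).+1)%N.
Proof. by case: l => // l; rewrite !expnS expn0; nia. Qed.

Lemma order_factor (l : nat) :
  ((l ^ 6).-1 = (l ^ 2 - l + 1) * (l.+1 * (l ^ 3).-1))%N.
Proof.
rewrite mulnA GK_degreeM -[6%N]/(3 * 2)%N expnM.
by case: (l ^ 3)%N => // n; rewrite -mulnn; nia.
Qed.

(** If [a = g ^+ k], then [n] divides [k * e], so [d] divides [k]: in a cyclic group of order
    [d * e], the elements killed by [e] are [d]-th powers. *)
Lemma prim_root_exp (F : fieldType) (n d e : nat) (g a : F) :
    n.-primitive_root g -> n = (d * e)%N -> a ^+ e = 1 ->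
  exists z, z ^+ d = a.
Proof.
move=> g_prim n_def a_exp.
have n_gt0 := prim_order_gt0 g_prim.
have [k a_def] : {k : 'I_n | a = g ^+ k}.
  by apply: (prim_rootP g_prim); rewrite n_def mulnC exprM a_exp expr1n.
move: (nat_of_ord k) a_def => {}k a_def.
have : (n %| k * e)%N by rewrite (prim_order_dvd g_prim) exprM -a_def a_exp.
have e_gt0 : (0 < e)%N by lia.
rewrite n_def dvdn_pmul2r // => /dvdnP[c k_def].
by exists (g ^+ c); rewrite -exprM -k_def -a_def.
Qed.

(** * Rational points of the Hermitian and GK curves *)

(* Any affine rational point of the Hermitian curve lifts to the GK curve:
   with [a = y^(l^2) - y] one finds [a^(l+1) = x^(l^3) + x - y^(l^3+1)], which
   is fixed by the Frobenius of order 2 and hence lies in the field with [l^3]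
   elements, so that [a] is an [m]-th power. *)
Lemma hermitian_lift (F : finFieldType) (l : nat) (x y : F) :
    [pchar F].-nat l -> #|F| = (l ^ 6)%N ->
    y ^+ l.+1 = x ^+ l + x -> y ^+ (l ^ 2) != y ->
  exists z, z ^+ (l ^ 2 - l + 1) = y ^+ (l ^ 2) - y.
Proof.
move=> l_char cardF xyE y_nfix.
have [g] := finField_prim_root F; rewrite cardF => g_prim.
apply: (prim_root_exp g_prim (order_factor l)).
set a := y ^+ (l ^ 2) - y.
have a_neq0 : a ^+ l.+1 != 0 by rewrite expf_neq0 // subr_eq0.
have l_gt0 : (0 < l ^ 3)%N by rewrite expn_gt0; case/andP: l_char => ->.
have l3_char : [pchar F].-nat (l ^ 3)%N by rewrite pnatX l_char.
have frob6 (t : F) : t ^+ (l ^ 3) ^+ (l ^ 3) = t.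
  by rewrite -exprM -expnD -cardF expf_card.
suff a_fix : (a ^+ l.+1) ^+ (l ^ 3) = a ^+ l.+1.
  by apply: (mulfI a_neq0); rewrite mulr1 exprM -exprS prednK.
have -> : a ^+ l.+1 = x ^+ (l ^ 3) + x - y ^+ (l ^ 3) * y.
  have h0 : y * y ^+ l = x ^+ l + x by rewrite -exprS.
  have h1 := congr1 (fun t => t ^+ l) h0.
  have h2 := congr1 (fun t => t ^+ l) h1.
  move: h1 h2; rewrite !(exprMn, exprDn_pchar _ _ l_char) => h1 h2.
  rewrite exprSr /a (exprBn_pchar _ _ l_char) !expnS expn0 muln1 !exprM.
  move: h0 h1 h2; set y1 := y ^+ l; set y2 := y1 ^+ l; set y3 := y2 ^+ l.
  set x1 := x ^+ l; set x2 := x1 ^+ l; set x3 := x2 ^+ l => h0 h1 h2.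
  (* The first three products come from the Hermitian equation raised to the powers [l ^ 2], [l] and
     1; their alternating sum telescopes to [x3 + x]. *)
  have -> : (y3 - y1) * (y2 - y) = y2 * y3 - y1 * y2 + y * y1 - y3 * y by ring.
  rewrite h0 h1 h2; ring.
rewrite exprBn_pchar // exprDn_pchar // exprMn !frob6; ring.
Qed.

(* With [T : x |-> x^l], the operator [1 + T^3 = (1 + T)(1 - T + T^2)] is the
   trace onto the subfield with [l^3] elements, so every [u] in that subfield is
   [x^l + x] for a rational [x]; [y] is chosen so that [u = y^(l+1)] lies there. *)
Lemma hermitian_point (F : finFieldType) (l : nat) :
    (1 < l)%N -> [pchar F].-nat l -> #|F| = (l ^ 6)%N ->
  exists x y : F, [/\ y ^+ l.+1 = x ^+ l + x, y != 0 & y ^+ (l ^ 2) != y].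
Proof.
move=> l_gt1 l_char cardF.
have [g] := finField_prim_root F; rewrite cardF => g_prim.
have l3_gt1 : (1 < l ^ 3)%N by rewrite -{1}(exp1n 3) ltn_exp2r.
have l3_char : [pchar F].-nat (l ^ 3)%N by rewrite pnatX l_char.
have g_neq0 : g != 0.
  by rewrite (prim_root_eq0 g_prim) order_factor !muln_eq0; lia.
have frob6 (t : F) : t ^+ (l ^ 3) ^+ (l ^ 3) = t.
  by rewrite -exprM -expnD -cardF expf_card.
(* [w] is the generator [g] divided by its trace [t]. If [t] were 0, then [g ^+ (l ^ 3).-1] would be
   [-1], and [g] would have order at most [2 * (l ^ 3).-1], less than [(l ^ 6).-1]. *)
have [w w_tr] : exists w : F, w ^+ (l ^ 3) + w = 1.
  pose t := g ^+ (l ^ 3) + g.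
  have t_neq0 : t != 0.
    apply/eqP=> /eqP; rewrite addr_eq0 => /eqP tE.
    have : g ^+ (2 * (l ^ 3).-1) == 1.
      apply/eqP; rewrite mulnC exprM.
      have -> : g ^+ (l ^ 3).-1 = -1; last by rewrite sqrrN expr1n.
      by apply: (mulfI g_neq0); rewrite -exprS prednK ?tE ?mulrN1 //; lia.
    rewrite -(prim_order_dvd g_prim) => /dvdn_leq.
    rewrite order_factor mulnA GK_degreeM; nia.
  exists (g / t); rewrite exprMn exprVn exprDn_pchar // frob6 addrC.
  by rewrite [g + _]addrC -/t -mulrDl addrC divff.
(* This exponent makes [u] equal to [g ^+ (l ^ 3).+1], of order [(l ^ 3).-1], while [y] has order
   [l.+1 * (l ^ 3).-1], too large for the field with [l ^ 2] elements. *)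
pose y := g ^+ (l ^ 2 - l + 1).
have y_neq0 : y != 0 by rewrite expf_neq0.
pose u := y ^+ l.+1.
have u_fix : u ^+ (l ^ 3) = u.
  have u_neq0 : u != 0 by rewrite expf_neq0.
  rewrite -(prednK (ltnW l3_gt1)) exprS -[RHS]mulr1; congr (_ * _).
  by rewrite /u /y -!exprM -?mulnA -order_factor (prim_expr_order g_prim).
pose v := w * u.
have v_tr : v ^+ (l ^ 3) + v = u by rewrite exprMn u_fix -mulrDl w_tr mul1r.
(* This is [1 - T + T^2] applied to [v], so [1 + T] sends it to the trace of [v]. *)
exists (v - v ^+ l + v ^+ (l ^ 2)), y; split=> //.
  rewrite exprDn_pchar // exprBn_pchar // -/u -v_tr !expnS expn0 muln1 !exprM.
  ring.
apply/eqP=> y_fix.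
have : y ^+ (l ^ 2).-1 == 1.
  apply/eqP/(mulfI y_neq0); rewrite -exprS prednK ?y_fix ?mulr1 //.
  by rewrite expn_gt0 ltnW.
rewrite -exprM -(prim_order_dvd g_prim) order_factor dvdn_pmul2l ?addn1 //.
move/dvdn_leq; rewrite !expnS expn0; nia.
Qed.

(** * Diagonal automorphisms of the GK curve *)

(* The automorphisms [(x, y, z) |-> (x, zeta y, eta omega z)] permute the
   affine points of the GK curve lying in a plane [X = x T]. *)
Lemma GK_diagonal (F : fieldType) (l : nat) (x y z zeta eta omega : F)
    (i j : nat) :
    let m := (l ^ 2 - l + 1)%N in
    [pchar F].-nat l -> zeta ^+ l.+1 = 1 -> eta ^+ m = zeta -> omega ^+ m = 1 ->
    y ^+ l.+1 = x ^+ l + x -> z ^+ m = y ^+ (l ^ 2) - y ->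
  (y * zeta ^+ i) ^+ l.+1 = x ^+ l + x /\
  (z * eta ^+ i * omega ^+ j) ^+ m
    = (y * zeta ^+ i) ^+ (l ^ 2) - y * zeta ^+ i.
Proof.
move=> m l_char zetaE etaE omegaE yE zE.
split; first by rewrite exprMn exprAC zetaE expr1n mulr1.
have zeta_fix : zeta ^+ (l ^ 2) = zeta.
  have l_gt0 : (0 < l)%N by case/andP: l_char.
  have -> : (l ^ 2 = (l.+1 * l.-1).+1)%N by rewrite -mulnn; nia.
  by rewrite exprS exprM zetaE expr1n mulr1.
rewrite !exprMn exprAC etaE [omega ^+ j ^+ m]exprAC omegaE expr1n mulr1.
by rewrite [zeta ^+ i ^+ (l ^ 2)]exprAC zeta_fix zE mulrBl.
Qed.

(** All three are powers of a generator [g] of the multiplicative group: [eta = g ^+ (l ^ 3).-1] has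
    order [m * l.+1], so its powers [zeta = eta ^+ m] and [omega = eta ^+ l.+1] have orders [l.+1]
    and [m]. *)
Lemma GK_diagonal_exists (F : finFieldType) (l : nat) :
    let m := (l ^ 2 - l + 1)%N in
    (1 < l)%N -> [pchar F].-nat l -> #|F| = (l ^ 6)%N ->
  exists zeta eta omega : F,
    [/\ l.+1.-primitive_root zeta, eta ^+ m = zeta & m.-primitive_root omega].
Proof.
move=> m l_gt1 l_char cardF.
have [g] := finField_prim_root F; rewrite cardF => g_prim.
exists (g ^+ (m * (l ^ 3).-1)), (g ^+ (l ^ 3).-1), (g ^+ (l.+1 * (l ^ 3).-1)).
have N_def := order_factor l; split; last 2 first.
- by rewrite -exprM mulnC.
- have := dvdn_prim_root g_prim (_ : m %| (l ^ 6).-1)%N.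
  by rewrite N_def -/m mulKn ?dvdn_mulr // /m addn1 //; apply.
have := dvdn_prim_root g_prim (_ : l.+1 %| (l ^ 6).-1)%N.
by rewrite N_def -/m mulnCA mulKn ?dvdn_mulr //; apply.
Qed.

(** * Homogeneous forms and affine points *)

Lemma meval_dhomog (n d : nat) (R : comNzRingType) (p : {mpoly R[n]}) (k : R)
    (v : 'I_n -> R) :
  p \is d.-homog -> p.@[fun i => k * v i] = k ^+ d * p.@[v].
Proof.
move=> /dhomogP p_homog; rewrite !mevalE big_distrr big_seq [RHS]big_seq /=.
apply: eq_bigr => m /p_homog <-; rewrite mulrCA; congr (_ * _).
rewrite (eq_bigr (fun i => k ^+ m i * v i ^+ m i)) => [|i _]; last first.
  by rewrite exprMn.
by rewrite big_split /= prodrXr mdegE.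
Qed.

Lemma hcoord_neq0 (F : fieldType) (x y z : F) : hcoord x y z 1 != 0.
Proof.
by apply/eqP=> /rowP/(_ 3)/eqP; rewrite !mxE oner_eq0.
Qed.

Lemma affine_point_subproof (F : fieldType) (x y z : F) :
  \dim <[hcoord x y z 1]>%VS == 1%N.
Proof. by rewrite dim_vline hcoord_neq0. Qed.

Definition affine_point (F : fieldType) (x y z : F) : PG 3 F :=
  exist _ <[hcoord x y z 1]>%VS (affine_point_subproof x y z).

Lemma affine_point_inj (F : fieldType) (x y z x' y' z' : F) :
    affine_point x y z = affine_point x' y' z' ->
  [/\ x = x', y = y' & z = z'].
Proof.
move=> /(congr1 val) /= eq_line.
have /vlineP[k /rowP eq_v] : hcoord x y z 1 \in <[hcoord x' y' z' 1]>%VS.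
  by rewrite -eq_line memv_line.
have := eq_v 3; rewrite !mxE /= mulr1 => k1.
have := (eq_v 0, eq_v 1, eq_v 2); rewrite !mxE /= -k1 !mul1r.
by case=> [[]].
Qed.

Lemma vanishes_at_affine (F : fieldType) (d : nat) (f : {mpoly F[4]})
    (x y z : F) :
    f \is d.-homog -> f.@[hcoord x y z 1 0] = 0 ->
  vanishes_at f (affine_point x y z).
Proof.
move=> f_homog f0 _ /vlineP[k ->].
rewrite (meval_eq _ (v2 := fun i => k * hcoord x y z 1 0 i)) => [|i].
  by rewrite (meval_dhomog _ _ f_homog) f0 mulr0.
by rewrite mxE.
Qed.

(** A multiple of [H] vanishes at every zero of [H], so one zero of [H] off [f] rules out
    divisibility. *)
Lemma is_plane_curve_witness (F : fieldType) (H f : {mpoly F[4]}) (d : nat)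
    (v : 'I_4 -> F) :
  f \is d.-homog -> H.@[v] = 0 -> f.@[v] != 0 -> is_plane_curve H d f.
Proof.
move=> f_homog H0 /eqP f_neq0; split=> // -[g f_def].
by apply: f_neq0; rewrite f_def mevalM H0 mulr0.
Qed.

Lemma dhomog_linX (n : nat) (F : fieldType) (i j : 'I_n) (c : F) :
  'X_i - c *: 'X_j \is [in F[n], 1.-homog].
Proof. by rewrite rpredB ?dhomogZ // dhomogX /= mdeg1. Qed.

Theorem proposition3p5 (p h l : nat) (F : finFieldType)
  (p_prime : prime p) (h_gt0 : (0 < h)%N) (l_def : l = (p ^ h)%N)
  (cardF : #|F| = (l ^ 6)%N) :
  exists (S : seq (PG 3 F)) (H C Y : {mpoly F[4]}),
    [/\ uniq S,
        size S = (3 * (l ^ 2 - l + 1))%N,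
        [/\ is_plane H,
            is_plane_curve H 3 C
          & is_plane_curve H (l ^ 2 - l + 1) Y]
      & forall P : PG 3 F, P \in S ->
          [/\ on_GK l P, on_plane_curve H C P & on_plane_curve H Y P]].
Proof.
have p_char : p \in [pchar F].
  by apply: (card_finPcharP (n := h * 6)) => //; rewrite cardF l_def expnM.
have l_char : [pchar F].-nat l.
  by rewrite (eq_pnat _ (pcharf_eq p_char)) l_def pnatX pnat_id.
have l_gt1 : (1 < l)%N by rewrite l_def -(exp1n h) ltn_exp2r ?prime_gt1.
have [x [y [yE y_neq0 y_nfix]]] := hermitian_point l_gt1 l_char cardF.
have [z zE] := hermitian_lift l_char cardF yE y_nfix.
have [zeta [eta [omega]]] := GK_diagonal_exists l_gt1 l_char cardF.
set m := (l ^ 2 - l + 1)%N in zE * => -[zeta_prim etaE omega_prim].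
have m_gt0 : (0 < m)%N by rewrite /m addn1.
(* This keeps apart the points that differ only in the power of [omega]. *)
have z_neq0 : z != 0.
  apply: contraNneq y_nfix => z0.
  by rewrite -subr_eq0 -zE z0 expr0n eqn0Ngt m_gt0.
have eta_neq0 : eta != 0.
  apply/eqP=> eta0; move: (prim_root_eq0 zeta_prim).
  by rewrite -etaE eta0 expr0n eqn0Ngt m_gt0 eqxx.
have GK_pt i j := GK_diagonal i j l_char (prim_expr_order zeta_prim) etaE
  (prim_expr_order omega_prim) yE zE.
pose pt i j : PG 3 F :=
  affine_point x (y * zeta ^+ i) (z * eta ^+ i * omega ^+ j).
pose H : {mpoly F[4]} := 'X_0 - x *: 'X_3.
pose C : {mpoly F[4]} := \prod_(i < 3) ('X_1 - (y * zeta ^+ i) *: 'X_3).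
pose Y : {mpoly F[4]} :=
  y *: 'X_2 ^+ m - (y ^+ (l ^ 2) - y) *: ('X_1 * 'X_3 ^+ m.-1).
have H_homog : H \is 1.-homog by apply: dhomog_linX.
have C_homog : C \is 3.-homog.
  rewrite /C !big_ord_recr big_ord0 /=.
  rewrite mul1r.
  by rewrite (dhomogM (d := 2)) ?dhomog_linX // (dhomogM (d := 1)) ?dhomog_linX.
have X_homog i : 'X_i \is [in F[4], 1.-homog] by rewrite dhomogX /= mdeg1.
have Y_homog : Y \is m.-homog.
  have := dhomogM (X_homog 1) (dhomogMn m.-1 (X_homog 3)).
  have := dhomogMn m (X_homog 2).
  by rewrite !mul1n add1n prednK // => ? ?; rewrite rpredB ?dhomogZ.
have HE v : H.@[v] = v 0 - x * v 3 by rewrite mevalB mevalZ !mevalXU.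
have CE v : C.@[v] = \prod_(i < 3) (v 1 - y * zeta ^+ i * v 3).
  rewrite /C rmorph_prod; apply: eq_bigr => i _.
  by rewrite /= mevalB mevalZ !mevalXU.
have YE v : Y.@[v] = y * v 2 ^+ m - (y ^+ (l ^ 2) - y) * (v 1 * v 3 ^+ m.-1).
  by rewrite mevalB !mevalZ mevalM !rmorphXn /= !mevalXU.
exists [seq pt i j | i <- iota 0 3, j <- iota 0 m], H, C, Y; split.
- apply: allpairs_uniq => [||u v]; rewrite ?iota_uniq //.
  move=> /allpairsP[[i j] [i_lt j_lt ->]].
  move=> /allpairsP[[i' j'] [i'_lt j'_lt ->]] /= /affine_point_inj[_].
  rewrite !mem_iota !add0n /= in i_lt i'_lt j_lt j'_lt.
  move/(mulfI y_neq0)/eqP; rewrite (eq_prim_root_expr zeta_prim).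
  (* Since [1 < l], the order [l.+1] of [zeta] is at least 3, which separates the three lines. *)
  have lt_l k : (k < 3 -> k < l.+1)%N by move/leq_trans; apply.
  rewrite (modn_small (lt_l i i_lt)) (modn_small (lt_l i' i'_lt)) => /eqP <-.
  move/mulfI => /(_ _)/eqP; rewrite (eq_prim_root_expr omega_prim).
  rewrite !modn_small // => e; congr (_, _); apply/eqP/e.
  by rewrite mulf_neq0 ?expf_neq0.
- by rewrite size_allpairs !size_iota.
- split.
  + split=> //; apply/eqP=> H0.
    have := HE (delta_mx (0 : 'I_1) 0 0).
    rewrite H0 meval0 !mxE /= mulr0 subr0 => /esym/eqP.
    by rewrite oner_eq0.
  (* The witnesses are points at infinity of the plane: [C] is 1 at [(0 : 1 : 0 : 0)], and [Y] is
     [y] at [(0 : 0 : 1 : 0)]. *)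
  + apply: (is_plane_curve_witness (v := delta_mx (0 : 'I_1) 1 0)) => //.
      by rewrite HE !mxE /= mulr0 subr0.
    by rewrite CE big1 ?oner_neq0 // => i _; rewrite !mxE /= mulr0 subr0.
  + apply: (is_plane_curve_witness (v := delta_mx (0 : 'I_1) 2 0)) => //.
      by rewrite HE !mxE /= mulr0 subr0.
    by rewrite YE !mxE /= expr1n mul0r mulr0 subr0 mulr1.
move=> _ /allpairsP[[i j] /= [i_lt _ ->]].
have [on_hermitian on_cover] := GK_pt i j.
have H_pt : vanishes_at H (pt i j).
  by apply: vanishes_at_affine H_homog _; rewrite HE !mxE /= mulr1 subrr.
split; first by right; do 3 eexists; split; rewrite // addn1.
- split=> //; apply: vanishes_at_affine C_homog _; rewrite CE.
  rewrite -[[:: _; _; _]]/(iota 0 3) mem_iota in i_lt.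
  by rewrite (bigD1 (Ordinal (i_lt : (i < 3)%N))) //= !mxE /= mulr1 subrr mul0r.
split=> //; apply: vanishes_at_affine Y_homog _; rewrite YE !mxE /=.
(* Both terms of [Y] reduce to [y * z ^+ m * zeta ^+ i]. *)
rewrite !exprMn expr1n mulr1 exprAC etaE [omega ^+ j ^+ m]exprAC.
by rewrite (prim_expr_order omega_prim) expr1n mulr1 -zE; ring.
Qed.
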